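(* Let $L$ be a purely transcendental field extension of a field $K$. Then $K \subset L$ satisfies the linear acyclic matching property.
   Context: Let $K \subset L$ be a field extension. Dimensions and linearity are over $K$; $\langle S\rangle$ denotes the $K$-subspace of $L$ generated by $S$; for subsets $A, B$ of $L$, $AB := \{ab : a \in A,\ b \in B\}$. Let $A$ and $B$ be $n$-dimensional $K$-subspaces of $L$, $n \ge 1$. An ordered basis $\{a_1,\dots,a_n\}$ of $A$ is matched to an ordered basis $\{b_1,\dots,b_n\}$ of $B$ if $a_i^{-1}A \cap B \subset \langle b_1,\dots,\hat{b}_i,\dots,b_n\rangle$ for all $1 \le i \le n$, where $\hat{b}_i$ means that $b_i$ is omitted. A linear isomorphism $f : A \to B$ is a strong matching from $A$ to $B$ if every ordered basis $\{a_1,\dots,a_n\}$ of $A$ is matched to the ordered basis $\{f(a_1),\dots,f(a_n)\}$ of $B$. Two linear isomorphisms $f, g : A \to B$ are equivalent if there exists a linear automorphism $\phi : A \to A$ such that $a f(a) = \phi(a) g(\phi(a))$ for all $a \in A$; two strong matchings are equivalent if they are equivalent as linear isomorphisms. An acyclic matching from $A$ to $B$ is a strong matching $f : A \to B$ such that for any strong matching $g : A \to B$ equivalent to $f$, one has $f = cg$ for some constant $c \in K$. The extension $K \subset L$ satisfies the linear acyclic matching property if for every pair $A, B$ of nonzero finite dimensional $K$-subspaces of $L$ of the same dimension with $AB \cap A = \{0\}$, there is at least one acyclic matching from $A$ to $B$. *)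

(* Defs.v *)
(* A field extension K < L is given by a ring morphism iota : K -> L; L may be
   infinite-dimensional over K. The K-vector space structure of L is
   c . x := iota c * x. Subsets of L are Prop-valued sets. A map A -> B between
   subspaces is a total function L -> L of which only the values on A are
   ever used. *)
From mathcomp Require Import all_boot all_algebra.
From mathcomp Require Import boolp classical_sets functions.
From mathcomp Require Import mpoly.
Set Implicit Arguments.
Unset Strict Implicit.
Unset Printing Implicit Defensive.
Import GRing.Theory.
Local Open Scope classical_set_scope.
Local Open Scope ring_scope.

Section FieldExtension.
Variables (K L : fieldType) (iota : {rmorphism K -> L}).
Implicit Types (A B S V : set L) (f g : L -> L).

Definition subspace V : Prop :=
  V 0 /\ forall (c : K) (x y : L), V x -> V y -> V (iota c * x + y).

Definition span S : set L := smallest subspace S.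

Definition lin_indep n (v : 'I_n -> L) : Prop :=
  forall c : 'I_n -> K, \sum_(i < n) iota (c i) * v i = 0 -> forall i, c i = 0.

Definition ordered_basis n A (v : 'I_n -> L) : Prop :=
  lin_indep v /\ span (range v) = A.

Definition has_dim A n : Prop :=
  subspace A /\ exists v : 'I_n -> L, ordered_basis A v.

Definition mulset A B : set L := [set a * b | a in A & b in B].

Definition lin_iso A B f : Prop :=
  set_bij A B f /\
  forall (c : K) (x y : L), A x -> A y -> f (iota c * x + y) = iota c * f x + f y.

Definition matched n A B (a b : 'I_n -> L) : Prop :=
  forall i : 'I_n,
    [set (a i)^-1 * x | x in A] `&` B `<=` span (b @` [set j | j != i]).

Definition strong_matching A B f : Prop :=
  lin_iso A B f /\
  forall n (a : 'I_n -> L), ordered_basis A a -> matched A B a (f \o a).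

Definition equivalent A f g : Prop :=
  exists2 phi : L -> L, lin_iso A A phi &
    forall a, A a -> a * f a = phi a * g (phi a).

Definition acyclic_matching A B f : Prop :=
  strong_matching A B f /\
  forall g, strong_matching A B g -> equivalent A f g ->
    exists c : K, forall a, A a -> f a = iota c * g a.

Definition linear_acyclic_matching_property : Prop :=
  forall (n : nat) A B, (0 < n)%N -> has_dim A n -> has_dim B n ->
    mulset A B `&` A = [set 0] ->
    exists f : L -> L, acyclic_matching A B f.

Definition subfield V : Prop :=
  [/\ V 1, forall x y, V x -> V y -> V (x - y)
         & forall x y, V x -> V y -> V (x / y)].

Definition alg_indep S : Prop :=
  forall n (s : 'I_n -> L), injective s -> (forall i, S (s i)) ->
    forall p : {mpoly K[n]}, mmap iota s p = 0 -> p = 0.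

(* L = K(S) for some algebraically independent S, of any cardinality;
   S = set0, i.e. L = K, is allowed. *)
Definition purely_transcendental : Prop :=
  exists2 S : set L, alg_indep S & smallest subfield (range iota `|` S) = setT.

End FieldExtension.

(* Main.v *)
(* If AB meets A trivially, every linear isomorphism A -> B is a strong
   matching. Polarizing a f(a) = phi(a) psi(a), with psi = g o phi, yields
   (phi x y - phi y x)(phi x f(y) - phi y f(x)) = 0, so phi(a)/a or phi(a)/f(a)
   is constant on A \ {0}; polarization makes this work over every field, F_2
   included. If B = mu A we choose f to be multiplication by mu, and any
   isomorphism otherwise; the second case then reduces to the first or is
   impossible, so phi(a) = l a. Since l A = A, Cayley-Hamilton shows that l is
   algebraic over K, hence lies in K, as K is algebraically closed in a purely
   transcendental extension: comparing leading monomials in an algebraic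
   equation of a fraction P/Q forces P and Q, and then also P - cQ and Q for
   c = lc(P)/lc(Q) unless P = cQ, to have the same leading monomial. Finally
   f = l^2 g. *)
Require Import Defs.
From HB Require Import structures.
From mathcomp Require Import all_boot all_order all_algebra.
From mathcomp Require Import boolp classical_sets functions.
From mathcomp Require Import mpoly.
From mathcomp Require Import ring.
Set Implicit Arguments.
Unset Strict Implicit.
Unset Printing Implicit Defensive.
Import Order.TTheory GRing.Theory.
Local Open Scope ring_scope.

(** * Leading monomials and algebraic fractions *)

Lemma ltm_muln n (m1 m2 : 'X_{1..n}) k :
  (m1 < m2)%O -> ((m1 *+ k.+1)%MM < (m2 *+ k.+1)%MM)%O.
Proof.
move=> lt12; elim: k => [|k IHk]; first by rewrite !mulm1n.
by rewrite mulmS [X in (_ < X)%O]mulmS ltm_add.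
Qed.

Section FieldExtension.
Variables (K L : fieldType) (iota : {rmorphism K -> L}).
Implicit Types (A B S V : set L) (f g : L -> L).

Section LeadingMonomial.
Variables (n : nat) (s : 'I_n -> L).
Hypothesis s_free : forall p : {mpoly K[n]}, mmap iota s p = 0 -> p = 0.

(* Homogenizing a monic equation of P/Q of degree d gives a K-combination of
   the P^k Q^(d-k) in which P^d would have the strictly largest leading
   monomial. *)
Lemma integral_mlead_le (P Q : {mpoly K[n]}) :
  mmap iota s Q != 0 -> integralOver iota (mmap iota s P / mmap iota s Q) ->
  (mlead P <= mlead Q)%O.
Proof.
move=> hQ [c c_mon /rootP]; rewrite horner_coef size_map_poly => eqc.
rewrite leNgt; apply/negP => ltQP.
have Q0 : Q != 0 by apply: contraNneq hQ => ->; rewrite mmap0.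
have P0 : P != 0.
  by apply: contraTneq ltQP => ->; rewrite mlead0 -leNgt le0m.
set d := (size c).-1.
have size_c : size c = d.+1 by rewrite prednK // size_poly_gt0 monic_neq0.
pose F := \sum_(k < d.+1) c`_k *: (P ^+ k * Q ^+ (d - k)).
have F0 : F = 0.
  apply: s_free; rewrite raddf_sum /=.
  have := congr1 ( *%R (mmap iota s Q ^+ d)) eqc.
  rewrite mulr0 size_c mulr_sumr; apply: etrans.
  apply: eq_bigr => k _.
  rewrite coef_map /= mmapZ rmorphM !rmorphXn /= expr_div_n.
  have -> : mmap iota s Q ^+ d = mmap iota s Q ^+ (d - k) * mmap iota s Q ^+ k.
    by rewrite -exprD subnK // -ltnS.
  by field; rewrite expf_neq0.
(* At this monomial the term [k = d] contributes a power of the leading coefficient of [P], hence a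
   nonzero value; all other terms contribute 0. *)
have /eqP := congr1 (mcoeff (mlead P *+ d)) F0.
rewrite raddf_sum /= big_ord_recr /= big1 ?add0r => [|k _].
  rewrite subnn expr0 mulr1 mcoeffZ mleadcX mcoeff0.
  have -> : c`_d = 1 by move: c_mon; rewrite monicE => /eqP.
  by rewrite mul1r expf_eq0 mleadc_eq0 (negPf P0) andbF.
rewrite mcoeffZ mcoeff_gt_mlead ?mulr0 //.
rewrite mleadM ?expf_neq0 // !mleadX //.
have lt_kd := ltn_ord k.
(* Splitting off [k] copies of [mlead P] leaves [mlead Q < mlead P], multiplied by the positive
   number [d - k]. *)
have -> : (mlead P *+ d = mlead P *+ k + mlead P *+ (d - k))%MM.
  by apply/mnmP => i; rewrite mnmDE !mulmnE -mulnDr subnKC // ltnW.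
rewrite ltmc_add2r.
by rewrite -(prednK (_ : (0 < d - k)%N)) ?subn_gt0 // ltm_muln.
Qed.

Lemma algebraic_fraction_const (P Q : {mpoly K[n]}) :
  mmap iota s Q != 0 ->
  algebraicOver iota (mmap iota s P / mmap iota s Q) ->
  exists c, mmap iota s P / mmap iota s Q = iota c.
Proof.
have mmap_neq0 p : p != 0 -> mmap iota s p != 0.
  by apply: contraNneq => /s_free ->.
have eq_mlead (p q : {mpoly K[n]}) : p != 0 -> q != 0 ->
    algebraicOver iota (mmap iota s p / mmap iota s q) -> mlead p = mlead q.
  move=> p0 q0 algpq; apply: le_anti; apply/andP; split.
    by apply: integral_mlead_le; [exact: mmap_neq0 | exact/integral_algebraic].
  apply: integral_mlead_le; first exact: mmap_neq0.
  by apply/integral_algebraic; rewrite -invf_div; apply: algebraic_inv.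
move=> hQ algPQ.
have Q0 : Q != 0 by apply: contraNneq hQ => ->; rewrite mmap0.
have [P0 | P0] := eqVneq P 0.
  by exists 0; rewrite P0 mmap0 mul0r rmorph0.
have ePQ := eq_mlead _ _ P0 Q0 algPQ.
pose c := mleadc P / mleadc Q; exists c.
have [PcQ | PcQ] := eqVneq (P - c *: Q) 0.
  by move/eqP: PcQ; rewrite subr_eq0 => /eqP->; rewrite mmapZ mulfK.
(* The fraction [P/Q - c] is still algebraic, so [P - cQ] has the leading monomial of [Q]; but [c]
   was chosen to cancel the coefficient there. *)
have /eqP : (P - c *: Q)@_(mlead (P - c *: Q)) = 0.
  rewrite (eq_mlead (P - c *: Q) Q) //; last first.
    by rewrite mmapB mmapZ mulrBl mulfK //; apply: algebraic_sub => //; apply: algebraic_id.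
  by rewrite mcoeffB mcoeffZ /c ePQ divfK ?subrr // mleadc_eq0.
by rewrite mleadc_eq0 (negPf PcQ).
Qed.

End LeadingMonomial.

(** * Fractions in finitely many generators *)

Definition poly_in (t : seq L) (x : L) : Prop :=
  exists P : {mpoly K[size t]}, x = mmap iota (tnth (in_tuple t)) P.

Lemma poly_inC t c : poly_in t (iota c).
Proof. by exists c%:MP; rewrite mmapC. Qed.

Lemma poly_inB t x y : poly_in t x -> poly_in t y -> poly_in t (x - y).
Proof. by move=> [P ->] [Q ->]; exists (P - Q); rewrite mmapB. Qed.

Lemma poly_inD t x y : poly_in t x -> poly_in t y -> poly_in t (x + y).
Proof. by move=> [P ->] [Q ->]; exists (P + Q); rewrite mmapD. Qed.

Lemma poly_inM t x y : poly_in t x -> poly_in t y -> poly_in t (x * y).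
Proof. by move=> [P ->] [Q ->]; exists (P * Q); rewrite rmorphM. Qed.

Lemma poly_in1 t : poly_in t 1.
Proof. by rewrite -(rmorph1 iota); apply: poly_inC. Qed.

Lemma poly_in_mem (t : seq L) x : x \in t -> poly_in t x.
Proof.
move=> /(tnthP (in_tuple t)) [i ->].
by exists 'X_i; rewrite mmapX mmap1U.
Qed.

(** Instead of renaming variables, the value of [P] is expanded into monomials and rebuilt by the
    closure properties of [poly_in u]. *)
Lemma poly_in_sub (t u : seq L) x : {subset t <= u} -> poly_in t x -> poly_in u x.
Proof.
move=> tu [P ->]; rewrite /mmap.
apply: (big_ind (poly_in u)) => [|y z|m _].
- by rewrite -(rmorph0 iota); apply: poly_inC.
- exact: poly_inD.
apply: poly_inM; first exact: poly_inC.
rewrite /mmap1; apply: (big_ind (poly_in u)) => [|y z|i _].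
- exact: poly_in1.
- exact: poly_inM.
elim: (m i) => [|k IHk]; first exact: poly_in1.
rewrite exprS; apply: poly_inM => //.
by apply/poly_in_mem/tu; rewrite (mem_tnth i (in_tuple t)).
Qed.

(** Requiring [uniq t] makes the enumeration of [t] injective, as [alg_indep] demands. *)
Definition frac_of S (x : L) : Prop :=
  exists t : seq L, [/\ uniq t, forall y, y \in t -> S y
    & exists p q, [/\ poly_in t p, poly_in t q, q != 0 & x = p / q]].

Lemma frac_of_common S x y : frac_of S x -> frac_of S y ->
  exists t : seq L, [/\ uniq t, forall y, y \in t -> S y
    & exists p q p' q', [/\ [/\ poly_in t p, poly_in t q, q != 0 & x = p / q]
       & [/\ poly_in t p', poly_in t q', q' != 0 & y = p' / q']]].
Proof.
move=> [t [_ tS [p [q [tp tq q0 ->]]]]] [u [_ uS [p' [q' [up uq q'0 ->]]]]].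
have t_sub : {subset t <= undup (t ++ u)}.
  by move=> z zt; rewrite mem_undup mem_cat zt.
have u_sub : {subset u <= undup (t ++ u)}.
  by move=> z zu; rewrite mem_undup mem_cat zu orbT.
exists (undup (t ++ u)); split; first exact: undup_uniq.
  by move=> z; rewrite mem_undup mem_cat => /orP[/tS|/uS].
exists p, q, p', q'; split; split=> //.
- exact: poly_in_sub t_sub tp.
- exact: poly_in_sub t_sub tq.
- exact: poly_in_sub u_sub up.
- exact: poly_in_sub u_sub uq.
Qed.

Lemma subfield_frac_of S : subfield (frac_of S).
Proof.
split.
- exists [::]; split=> //; exists 1, 1.
  by split; rewrite ?oner_eq0 ?divr1 //; apply: poly_in1.
- move=> x y /frac_of_common h /h [t [ut tS]].
  move=> [p [q [p' [q' [[tp tq q0 ->] [tp' tq' q'0 ->]]]]]].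
  exists t; split=> //; exists (p * q' - p' * q), (q * q'); split.
  + by apply: poly_inB; apply: poly_inM.
  + exact: poly_inM.
  + by rewrite mulf_neq0.
  + by field; rewrite q0 q'0.
- move=> x y /frac_of_common h /h [t [ut tS]].
  move=> [p [q [p' [q' [[tp tq q0 ->] [tp' tq' q'0 ->]]]]]].
  exists t; split=> //.
  (* Here the divisor is 0, and division by 0 gives 0 by convention. *)
  have [->|p'0] := eqVneq p' 0.
    exists 0, 1; rewrite mul0r invr0 mulr0 divr1 oner_eq0; split=> //.
      by rewrite -(rmorph0 iota); apply: poly_inC.
    exact: poly_in1.
  exists (p * q'), (q * p'); split; try exact: poly_inM.
    by rewrite mulf_neq0.
  by field; rewrite q0 p'0 q'0.
Qed.

(** The fractions in elements of [S] form a subfield containing [K] and [S], so they exhaust [L],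
    and each one involves only finitely many independent elements. *)
Lemma purely_transcendental_algebraic : purely_transcendental iota ->
  forall x, algebraicOver iota x -> exists c, x = iota c.
Proof.
move=> [S indepS genS] x algx.
have : frac_of S x.
  have : smallest (@subfield L) (range iota `|` S)%classic x by rewrite genS.
  apply; split; first exact: subfield_frac_of.
  move=> y [[c _ <-]|Sy].
    exists [::]; split=> //; exists (iota c), 1.
    by rewrite oner_eq0 divr1; split=> //; [exact: poly_inC|exact: poly_in1].
  exists [:: y]; split=> //; first by move=> z; rewrite inE => /eqP->.
  exists y, 1; rewrite oner_eq0 divr1; split=> //; last exact: poly_in1.
  by apply: poly_in_mem; rewrite inE.
move=> [t [ut tS [_ [_ [[P ->] [Q ->] Q0 ex]]]]].
rewrite ex in algx *; apply: algebraic_fraction_const => //.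
apply: indepS; first by apply/tuple_uniqP.
by move=> i; apply/tS; rewrite (mem_tnth i (in_tuple t)).
Qed.

(** * Spans, bases and linear isomorphisms *)

Lemma subspace_sum V n (c : 'I_n -> K) (v : 'I_n -> L) :
  subspace iota V -> (forall i, V (v i)) -> V (\sum_i iota (c i) * v i).
Proof.
move=> [V0 VD] Vv; apply: (big_rec V) => // i x _ Vx; exact: VD.
Qed.

Lemma span_rangeP n (v : 'I_n -> L) x :
  Defs.span iota (range v) x <-> exists c, x = \sum_i iota (c i) * v i.
Proof.
split.
  move=> h; apply: (h (fun y => exists c : 'I_n -> K, y = \sum_i iota (c i) * v i)).
  split; first split.
  - by exists (fun=> 0); rewrite big1 // => i _; rewrite rmorph0 mul0r.
  - move=> a _ _ [c ->] [d ->]; exists (fun i => a * c i + d i).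
    rewrite mulr_sumr -big_split /=; apply: eq_bigr => i _.
    by rewrite rmorphD rmorphM mulrDl mulrA.
  move=> _ [i _ <-]; exists (fun j => (j == i)%:R).
  rewrite (bigD1 i) //= eqxx rmorph1 mul1r big1 ?addr0 // => j /negPf->.
  by rewrite rmorph0 mul0r.
move=> [c ->] V [sV vV]; apply: subspace_sum => // i.
by apply: vV; exists i.
Qed.

Lemma ordered_basis_neq0 A n (a : 'I_n -> L) i :
  ordered_basis iota A a -> a i != 0.
Proof.
move=> [ai _]; apply/eqP => ai0.
have /ai/(_ i)/eqP : \sum_j iota (j == i)%:R * a j = 0.
  rewrite (bigD1 i) //= ai0 mulr0 big1 ?addr0 // => j /negPf->.
  by rewrite rmorph0 mul0r.
by rewrite eqxx oner_eq0.
Qed.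

Lemma ordered_basis_mem A n (a : 'I_n -> L) i : ordered_basis iota A a -> A (a i).
Proof. by move=> [_ <-] V [_ aV]; apply: aV; exists i. Qed.

Lemma stable_algebraic A n (l : L) : (0 < n)%N -> has_dim iota A n ->
  (forall x, A x -> A (l * x)) -> algebraicOver iota l.
Proof.
move=> n0 [sA [a ba]] lA.
have /choice [M eM] : forall i, exists c : 'I_n -> K, l * a i = \sum_j iota (c j) * a j.
  move=> i; apply/span_rangeP.
  have -> : Defs.span iota (range a) = A by case: ba.
  exact/lA/(ordered_basis_mem _ ba).
(* Eigenvectors are row vectors acted on from the right, hence the transpose; the basis, as a row
   over [L], is an eigenvector for [l]. *)
pose N : 'M[K]_n := \matrix_(i, j) M j i.
exists (char_poly N); first exact/monic_neq0/char_poly_monic.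
rewrite (map_char_poly iota) -eigenvalue_root_char.
apply/eigenvalueP; exists (\row_j a j); last first.
  apply/eqP => /rowP/(_ (Ordinal n0)); rewrite !mxE => /eqP.
  by rewrite (negPf (ordered_basis_neq0 _ ba)).
apply/rowP => i; rewrite !mxE eM; apply: eq_bigr => j _.
by rewrite !mxE mulrC.
Qed.

Lemma has_dim_lin_iso A B n : has_dim iota A n -> has_dim iota B n ->
  exists f, lin_iso iota A B f.
Proof.
move=> [sA [a [ai aA]]] [sB [b [bi bB]]].
have AP x : A x <-> exists c, x = \sum_i iota (c i) * a i.
  by rewrite -aA; apply: span_rangeP.
have BP x : B x <-> exists c, x = \sum_i iota (c i) * b i.
  by rewrite -bB; apply: span_rangeP.
have inj v : lin_indep iota v -> forall c d : 'I_n -> K,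
    \sum_i iota (c i) * v i = \sum_i iota (d i) * v i -> c = d.
  move=> vi c d /eqP; rewrite -subr_eq0 -sumrB => /eqP e0; apply/funext => i.
  apply/eqP; rewrite -subr_eq0; apply/eqP; apply: (vi (fun i => c i - d i)).
  by rewrite -[RHS]e0; apply: eq_bigr => j _; rewrite rmorphB mulrBl.
(* The map carries coordinates in [a] to coordinates in [b]; outside [A] the condition is vacuous
   and the value 0 is taken. *)
have /choice [f fP] : forall x, exists y, forall c : 'I_n -> K,
    x = \sum_i iota (c i) * a i -> y = \sum_i iota (c i) * b i.
  move=> x; have [[c ec]|nc] :=
    pselect (exists c : 'I_n -> K, x = \sum_i iota (c i) * a i).
    exists (\sum_i iota (c i) * b i) => d ed.
    by congr bigop; rewrite (inj _ ai c d) // -ec.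
  by exists 0 => c ec; case: nc; exists c.
exists f; split; first split.
- by move=> x /AP[c /fP ->]; apply/BP; exists c.
- move=> x y; rewrite !inE => /AP[c ec] /AP[d ed]; rewrite (fP _ _ ec) (fP _ _ ed).
  by move/(inj _ bi) => cd; rewrite ec ed cd.
- move=> y /BP[c ->]; exists (\sum_i iota (c i) * a i); last exact: fP.
  by apply/AP; exists c.
move=> k x y /AP[c ec] /AP[d ed].
rewrite (fP _ _ ec) (fP _ _ ed) mulr_sumr -big_split /=.
rewrite (fP _ (fun i => k * c i + d i)).
  by apply: eq_bigr => i _; rewrite rmorphD rmorphM mulrDl mulrA.
rewrite ec ed mulr_sumr -big_split /=.
by apply: eq_bigr => i _; rewrite rmorphD rmorphM mulrDl mulrA.
Qed.

(** If [x] in [A] has [a_i^-1 x] in [B], then [x] lies in both [AB] and [A], so it is 0: the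
    intersection to be matched is trivial. *)
Lemma lin_iso_strong_matching A B f :
  (mulset A B `&` A = [set 0])%classic -> subspace iota A ->
  lin_iso iota A B f -> strong_matching iota A B f.
Proof.
move=> AB0 sA ff; split=> // n a ba i _ [[x Ax <-] Bx].
have : (mulset A B `&` A)%classic (a i * ((a i)^-1 * x)).
  split; last by rewrite mulVKf // (ordered_basis_neq0 _ ba).
  by exists (a i); [exact: (ordered_basis_mem _ ba) | exists ((a i)^-1 * x)].
rewrite AB0 => /= /eqP.
rewrite mulf_eq0 (negPf (ordered_basis_neq0 _ ba)) /= => /eqP ->.
by move=> V [[V0 _] _].
Qed.

Lemma lin_isoD A B f x y : lin_iso iota A B f -> A x -> A y ->
  f (x + y) = f x + f y.
Proof.
by move=> [_ flin] Ax Ay; have := flin 1 x y Ax Ay; rewrite rmorph1 !mul1r.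
Qed.

Lemma lin_iso_fun0 A B f : subspace iota A -> lin_iso iota A B f -> f 0 = 0.
Proof.
move=> [A0 _] ff; have := lin_isoD ff A0 A0; rewrite addr0 => /eqP.
by rewrite -subr_eq0 opprD addNKr oppr_eq0 => /eqP.
Qed.

Lemma lin_iso_neq0 A B f x : subspace iota A -> lin_iso iota A B f ->
  A x -> x != 0 -> f x != 0.
Proof.
move=> sA ff Ax; apply: contraNneq => fx0.
case: (ff) => [[_ finj _] _].
by apply/eqP/finj; rewrite ?inE ?(lin_iso_fun0 sA ff) //; case: sA.
Qed.

(* A product of two linear forms determines the forms up to order and a
   scalar; here read off the polarization of [x * f x = phi x * psi x]. *)
Lemma product_dichotomy (x y fx fy px py qx qy : L) :
  x * fx = px * qx -> y * fy = py * qy ->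
  x * fy + y * fx = px * qy + py * qx ->
  px * y = py * x \/ px * fy = py * fx.
Proof.
move=> exx eyy exy.
have /eqP : (px * y - py * x) * (px * fy - py * fx) = 0.
  transitivity (px ^+ 2 * (y * fy) + py ^+ 2 * (x * fx)
                - px * py * (x * fy + y * fx)); first by ring.
  by rewrite exx eyy exy; ring.
rewrite mulf_eq0 !subr_eq0.
by case/orP => /eqP; [left | right].
Qed.

End FieldExtension.

(* The kernels of r and s are equivalence relations with total union. *)
Lemma const_or_const (T U V : Type) (D : set T) (r : T -> U) (s : T -> V) :
  (forall x y, D x -> D y -> r x = r y \/ s x = s y) ->
  (forall x y, D x -> D y -> r x = r y) \/ (forall x y, D x -> D y -> s x = s y).
Proof.
move=> rs; apply: contrapT => /not_orP [nr ns]; apply: nr => x y Dx Dy.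
have [//|sxy] := rs x y Dx Dy.
apply: contrapT => rxy; apply: ns.
(* A point [z] with [r z = r x] has [r z] different from [r y], so [s z = s y = s x]. *)
suff sx z : D z -> s z = s x by move=> z w /sx -> /sx ->.
move=> Dz; have [rzx|//] := rs z x Dz Dx.
by have [rzy|->//] := rs z y Dz Dy; case: rxy; rewrite -rzx.
Qed.

(** * Equivalent isomorphisms and acyclic matchings *)

Section Acyclic.
Variables (K L : fieldType) (iota : {rmorphism K -> L}).
Implicit Types (A B : set L) (f g : L -> L).

Lemma equivalent_dilation A B f g phi :
  subspace iota A -> lin_iso iota A B f -> lin_iso iota A B g ->
  lin_iso iota A A phi ->
  (forall a, A a -> a * f a = phi a * g (phi a)) ->
  exists l, (forall a, A a -> phi a = l * a) \/ (forall a, A a -> phi a = l * f a).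
Proof.
move=> sA ff gg pp eqv; have [A0 _] := sA.
have AD x y : A x -> A y -> A (x + y).
  by case: sA => _ /(_ 1 x y); rewrite rmorph1 mul1r.
have phiA x : A x -> A (phi x) by case: pp => [[pA _ _] _]; exact: pA.
pose D : set L := fun x => A x /\ x != 0.
pose r x := phi x / x; pose s x := phi x / f x.
have dich x y : D x -> D y -> r x = r y \/ s x = s y.
  move=> [Ax x0] [Ay y0].
  have fx0 := lin_iso_neq0 sA ff Ax x0.
  have fy0 := lin_iso_neq0 sA ff Ay y0.
  (* The equivalence at [x + y] is expanded and its instances at [x] and [y] are cancelled, with no
     division by 2. *)
  have : x * f y + y * f x = phi x * g (phi y) + phi y * g (phi x).
    have := eqv _ (AD _ _ Ax Ay).
    rewrite (lin_isoD ff) // (lin_isoD pp) // (lin_isoD gg); try exact: phiA.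
    rewrite !mulrDl !mulrDr (eqv x Ax) (eqv y Ay) => /eqP.
    by rewrite -!addrA (inj_eq (addrI _)) !addrA (inj_eq (addIr _)) => /eqP.
  case/(product_dichotomy (eqv x Ax) (eqv y Ay)) => e; [left|right].
    by apply/eqP; rewrite /r eqr_div // e.
  by apply/eqP; rewrite /s eqr_div // e.
(* The constant ratio is read off at [z]; if there is no such [z], then [A] is zero and any [l]
   works. *)
have [[z [Az z0]]|noD] := pselect (exists z, D z); last first.
  exists 0; left => a Aa; have [->|a0] := eqVneq a 0.
    by rewrite (lin_iso_fun0 sA pp) mulr0.
  by case: noD; exists a.
have [rc|sc] := const_or_const dich.
  exists (r z); left => a Aa; have [->|a0] := eqVneq a 0.
    by rewrite (lin_iso_fun0 sA pp) mulr0.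
  by rewrite (rc z a) // /r divfK.
exists (s z); right => a Aa; have [->|a0] := eqVneq a 0.
  by rewrite (lin_iso_fun0 sA pp) (lin_iso_fun0 sA ff) mulr0.
by rewrite (sc z a) // /s divfK // (lin_iso_neq0 sA ff).
Qed.

Hypothesis alg_closed : forall x, algebraicOver iota x -> exists c, x = iota c.

(** Since [phi] preserves [A], [l] is algebraic and so lies in [K]; linearity of [g] then turns the
    equivalence into [a f(a) = l^2 a g(a)]. *)
Lemma dilation_equivalent_const A B n f g phi (l : L) :
  (0 < n)%N -> has_dim iota A n -> lin_iso iota A B f -> lin_iso iota A B g ->
  lin_iso iota A A phi ->
  (forall a, A a -> a * f a = phi a * g (phi a)) ->
  (forall a, A a -> phi a = l * a) ->
  exists c : K, forall a, A a -> f a = iota c * g a.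
Proof.
move=> n0 dA ff gg pp eqv philE; have sA : subspace iota A by case: dA.
have [c lc] : exists c, l = iota c.
  apply/alg_closed/(stable_algebraic n0 dA) => x Ax.
  by rewrite -philE //; case: pp => [[pA _ _] _]; exact: pA.
exists (c ^+ 2) => a Aa; have [->|a0] := eqVneq a 0.
  by rewrite (lin_iso_fun0 sA ff) (lin_iso_fun0 sA gg) mulr0.
apply: (mulfI a0); rewrite eqv // philE // lc.
have -> : g (iota c * a) = iota c * g a.
  have [A0 _] := sA; case: (gg) => _ /(_ c a 0 Aa A0).
  by rewrite addr0 (lin_iso_fun0 sA gg) addr0.
by rewrite rmorphXn /=; ring.
Qed.

Lemma acyclic_matching_exists A B n : (0 < n)%N ->
  has_dim iota A n -> has_dim iota B n ->
  (mulset A B `&` A = [set 0])%classic ->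
  exists f, acyclic_matching iota A B f.
Proof.
move=> n0 dA dB AB0; have sA : subspace iota A by case: dA.
(* The choice of [f] must ensure that an automorphism of [A] proportional to [f] is also a
   dilation. *)
have [f [ff fP]] : exists f, lin_iso iota A B f /\
   (forall phi l, lin_iso iota A A phi -> (forall a, A a -> phi a = l * f a) ->
    exists l', forall a, A a -> phi a = l' * a).
  have [[m m_iso]|no_m] := pselect (exists m, lin_iso iota A B ( *%R m)).
    exists ( *%R m); split=> // phi l _ phiE; exists (l * m) => a Aa.
    by rewrite phiE // mulrA.
  have [f ff] := has_dim_lin_iso dA dB; exists f; split=> // phi l pp phiE.
  (* From [phi = l f] and [phi(A) = A] follows [A = l B], so multiplication by [l^-1] would be an
     isomorphism from [A] to [B]. *)
  case: no_m; exists l^-1.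
  have [_ [a0 ba]] := dA; pose a := a0 (Ordinal n0).
  have Aa : A a := ordered_basis_mem _ ba.
  have l0 : l != 0.
    have : phi a != 0 by apply: lin_iso_neq0 pp Aa (ordered_basis_neq0 _ ba).
    by apply: contraNneq => l0; rewrite phiE // l0 mul0r.
  case: (ff) => [[fAB _ fsurj] _]; case: (pp) => [[pAA _ psurj] _].
  split; last by move=> c x y _ _; ring.
  split.
  - move=> x /psurj [y Ay <-]; rewrite phiE // mulKf //; exact: fAB.
  - by move=> x y _ _; apply: mulfI; rewrite invr_eq0.
  - move=> y /fsurj [x Ax <-]; exists (phi x); first exact: pAA.
    by rewrite phiE // mulKf.
exists f; split; first exact: lin_iso_strong_matching.
move=> g [gg _] [phi pp eqv].
have [l [philE|philE]] := equivalent_dilation sA ff gg pp eqv.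
  exact: (dilation_equivalent_const n0 dA ff gg pp eqv philE).
have [l' phil'E] := fP _ _ pp philE.
exact: (dilation_equivalent_const n0 dA ff gg pp eqv phil'E).
Qed.

End Acyclic.

Theorem theorem4p5 (K L : fieldType) (iota : {rmorphism K -> L}) :
  purely_transcendental iota -> linear_acyclic_matching_property iota.
Proof.
move=> /purely_transcendental_algebraic alg_closed n A B n0 dA dB AB0.
exact: (acyclic_matching_exists alg_closed n0 dA dB AB0).
Qed.
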